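(* No Clifford torus of dimension $6$ is properly C-harmonic in $\mathbb{S}^7$; that is, for all positive integers $n_1,n_2$ with $n_1+n_2=6$ and all $a\in\,]0,1[$, $b=\sqrt{1-a^2}$, the torus $\mathbb{T}^{n_1+n_2}(a,b)=\mathbb{S}^{n_1}(a)\times\mathbb{S}^{n_2}(b)\subset\mathbb{S}^7$ is not properly C-harmonic in $\mathbb{S}^7$.
   Context: $\mathbb{S}^7\subset\mathbb{R}^8$ is the unit sphere with its canonical metric; $\mathbb{T}^{n_1+n_2}(a,b)=\{(x,y)\in\mathbb{R}^{n_1+1}\times\mathbb{R}^{n_2+1}:|x|=a,\ |y|=b\}\subset\mathbb{S}^7$, with the induced metric $g$. For a smooth map $\varphi:(M,g)\to(N,h)$, $T\varphi$ is its tangent map viewed as a $\varphi^*TN$-valued $1$-form, $d$ the covariant derivative on sections of $\varphi^*TN$, $\delta$ the divergence on $\varphi^*TN$-valued $1$-forms ($\delta\alpha=-\operatorname{tr}\nabla\alpha$), $\nabla^h$ the pulled-back connection on $\varphi^*TN$. $\varphi$ is harmonic if $\delta T\varphi=0$. $\mathrm{S}(X)=\sum_i R^h_{X,T\varphi(e_i)}T\varphi(e_i)$ ($(e_i)$ a $g$-orthonormal basis), $R^h$ the curvature tensor of $h$, sign convention $R_{X,Y}Z=\langle Y,Z\rangle X-\langle X,Z\rangle Y$ on the unit sphere. For $\dim M=6$ and $(N,h)$ symmetric, $\varphi$ is C-harmonic from $(M,[g])$ to $(N,h)$ if $$\Bigl(\delta d-\mathrm{S}+\tfrac{2\,\mathrm{Scal}}{15}\Bigr)\Bigl(\delta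 d-\mathrm{S}+\tfrac{\mathrm{Scal}}{5}\Bigr)\delta T\varphi-2\sum_i R^h_{\delta T\varphi,\,T\varphi(e_i)}\bigl(\nabla^h_{e_i}\delta T\varphi\bigr)=0,$$ where $\mathrm{Scal}$ is the scalar curvature of $(M,g)$. A submanifold is C-harmonic if its inclusion is C-harmonic, and properly C-harmonic if moreover its inclusion is not harmonic. *)

(* Defs.v *)
From mathcomp Require Import all_boot all_order all_algebra.
From mathcomp Require Import all_classical all_reals all_analysis.

Set Implicit Arguments.
Unset Strict Implicit.
Unset Printing Implicit Defensive.

Import Order.TTheory GRing.Theory Num.Theory numFieldNormedType.Exports.

Local Open Scope classical_set_scope.
Local Open Scope ring_scope.

(* Riemannian geometry of smooth submanifolds of Euclidean spaces.  A manifold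
   is a submanifold M of R^n ('rV[R]_n, as a set) with the metric induced by
   the standard scalar product; maps, sections and 1-forms on M are functions
   on R^n whose values outside M play no role. *)

Definition dotp (R : realType) (n : nat) (u v : 'rV[R]_n) : R :=
  \sum_(i < n) u 0 i * v 0 i.

(* The library norm of 'rV[R]_n is the sup norm; this one is Euclidean. *)
Definition enorm (R : realType) (n : nat) (u : 'rV[R]_n) : R :=
  Num.sqrt (dotp u u).

Definition unit_sphere (R : realType) (n : nat) : set 'rV[R]_n :=
  [set x | enorm x = 1].
Arguments unit_sphere : clear implicits.

(* T^{n1+n2}(a, b), with R^{n1+1} x R^{n2+1} = 'rV_(n1.+1 + n2.+1). *)
Definition clifford_torus (R : realType) (n1 n2 : nat) (a b : R) :
    set 'rV[R]_(n1.+1 + n2.+1) :=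
  [set p | enorm (lsubmx p) = a /\ enorm (rsubmx p) = b].
Arguments clifford_torus {R} n1 n2 a b.

Definition curve_through (R : realType) (n : nat) (M : set 'rV[R]_n)
    (p v : 'rV[R]_n) : set (R -> 'rV[R]_n) :=
  [set c | [/\ forall t, M (c t), c 0 = p & is_derive (0 : R) (1 : R) c v]].

Definition tangent (R : realType) (n : nat) (M : set 'rV[R]_n)
    (p : 'rV[R]_n) : set 'rV[R]_n :=
  [set v | curve_through M p v !=set0].

(* The derivative at p along v in T_pM of F : M -> R^k, i.e. (F o c)'(0) for
   a curve c in M with c(0) = p and c'(0) = v; for F differentiable on M the
   value does not depend on c. *)
Definition tderive (R : realType) (n k : nat) (M : set 'rV[R]_n)
    (F : 'rV[R]_n -> 'rV[R]_k) (p v : 'rV[R]_n) : 'rV[R]_k :=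
  'D_(1 : R) (F \o get (curve_through M p v)) (0 : R).

(* Orthogonal projection of R^n onto the linear subspace T. *)
Definition oproj (R : realType) (n : nat) (T : set 'rV[R]_n)
    (v : 'rV[R]_n) : 'rV[R]_n :=
  get [set w | T w /\ forall z, T z -> dotp (v - w) z = 0].

Definition orthonormal_basis (R : realType) (n m : nat) (T : set 'rV[R]_n) :
    set ('I_m -> 'rV[R]_n) :=
  [set e | [/\ forall i, T (e i),
               forall i j, dotp (e i) (e j) = (i == j)%:R
             & forall v, T v -> v = \sum_i dotp v (e i) *: e i]].

(* An orthonormal basis of T_pM, for M of dimension m. *)
Definition frame (R : realType) (n m : nat) (M : set 'rV[R]_n)
    (p : 'rV[R]_n) : 'I_m -> 'rV[R]_n :=
  get (@orthonormal_basis R n m (tangent M p)).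

(* The tangent vector field q |-> (projection of v onto T_qM), which takes the
   value v at p when v is in T_pM.  It serves to extend tangent vectors in
   expressions that are tensorial in the extended vector. *)
Definition tfield (R : realType) (n : nat) (M : set 'rV[R]_n)
    (v q : 'rV[R]_n) : 'rV[R]_n :=
  oproj (tangent M q) v.

(* nabla^h_v V at p for a section V of phi^*TN, phi : M -> N, with N of induced
   metric h: the Levi-Civita connection of N is the tangential part of the
   flat one. *)
Definition covd (R : realType) (n k : nat) (M : set 'rV[R]_n)
    (N : set 'rV[R]_k) (phi V : 'rV[R]_n -> 'rV[R]_k) (p v : 'rV[R]_n) :
    'rV[R]_k :=
  oproj (tangent N (phi p)) (tderive M V p v).

(* The Levi-Civita connection of M. *)
Definition nabla (R : realType) (n : nat) (M : set 'rV[R]_n)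
    (Y : 'rV[R]_n -> 'rV[R]_n) (p v : 'rV[R]_n) : 'rV[R]_n :=
  covd M M id Y p v.

Definition lie_bracket (R : realType) (n : nat) (M : set 'rV[R]_n)
    (X Y : 'rV[R]_n -> 'rV[R]_n) (p : 'rV[R]_n) : 'rV[R]_n :=
  tderive M Y p (X p) - tderive M X p (Y p).

(* R_{x,y} z at p, with the sign R_{X,Y} = [nabla_X, nabla_Y] - nabla_[X,Y],
   so that R_{x,y} z = <y, z> x - <x, z> y on the unit sphere. *)
Definition curvature (R : realType) (n : nat) (M : set 'rV[R]_n)
    (p x y z : 'rV[R]_n) : 'rV[R]_n :=
  let X := tfield M x in let Y := tfield M y in let Z := tfield M z in
  nabla M (fun q => nabla M Z q (Y q)) p (X p)
  - nabla M (fun q => nabla M Z q (X q)) p (Y p)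
  - nabla M Z p (lie_bracket M X Y p).

Definition scal (R : realType) (n m : nat) (M : set 'rV[R]_n)
    (p : 'rV[R]_n) : R :=
  let e := @frame R n m M p in
  \sum_(i < m) \sum_(j < m) dotp (curvature M p (e i) (e j) (e j)) (e i).

(* delta alpha = - tr (nabla alpha) for a phi^*TN-valued 1-form alpha on M of
   dimension m, where
   (nabla_X alpha)(Y) = nabla^h_X (alpha(Y)) - alpha(nabla_X Y). *)
Definition divergence (R : realType) (n k m : nat) (M : set 'rV[R]_n)
    (N : set 'rV[R]_k) (phi : 'rV[R]_n -> 'rV[R]_k)
    (alpha : 'rV[R]_n -> 'rV[R]_n -> 'rV[R]_k) (p : 'rV[R]_n) : 'rV[R]_k :=
  let e := @frame R n m M p in
  - \sum_(i < m) (covd M N phi (fun q => alpha q (tfield M (e i) q)) p (e i)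
                  - alpha p (nabla M (tfield M (e i)) p (e i))).

(* delta (T phi). *)
Definition delta_T (R : realType) (n k m : nat) (M : set 'rV[R]_n)
    (N : set 'rV[R]_k) (phi : 'rV[R]_n -> 'rV[R]_k) :
    'rV[R]_n -> 'rV[R]_k :=
  divergence m M N phi (tderive M phi).

Definition harmonic (R : realType) (n k m : nat) (M : set 'rV[R]_n)
    (N : set 'rV[R]_k) (phi : 'rV[R]_n -> 'rV[R]_k) : Prop :=
  forall p, M p -> delta_T m M N phi p = 0.

(* S(X) = sum_i R^h_{X, T phi(e_i)} T phi(e_i). *)
Definition S_op (R : realType) (n k m : nat) (M : set 'rV[R]_n)
    (N : set 'rV[R]_k) (phi X : 'rV[R]_n -> 'rV[R]_k) (p : 'rV[R]_n) :
    'rV[R]_k :=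
  let e := @frame R n m M p in
  \sum_(i < m) curvature N (phi p) (X p)
                 (tderive M phi p (e i)) (tderive M phi p (e i)).

(* (delta d - S + f) V, for a function f on M and a section V of phi^*TN. *)
Definition dS_op (R : realType) (n k m : nat) (M : set 'rV[R]_n)
    (N : set 'rV[R]_k) (phi : 'rV[R]_n -> 'rV[R]_k) (f : 'rV[R]_n -> R)
    (V : 'rV[R]_n -> 'rV[R]_k) (p : 'rV[R]_n) : 'rV[R]_k :=
  divergence m M N phi (covd M N phi V) p - S_op m M N phi V p + f p *: V p.

(* For M of dimension 6 and N symmetric. *)
Definition C_harmonic (R : realType) (n k : nat) (M : set 'rV[R]_n)
    (N : set 'rV[R]_k) (phi : 'rV[R]_n -> 'rV[R]_k) : Prop :=
  let tau := delta_T 6 M N phi in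
  forall p, M p ->
    let e := @frame R n 6 M p in
    dS_op 6 M N phi (fun q => 2 * scal 6 M q / 15)
      (dS_op 6 M N phi (fun q => scal 6 M q / 5) tau) p
    - 2 *: \sum_(i < 6) curvature N (phi p) (tau p) (tderive M phi p (e i))
                          (covd M N phi tau p (e i))
    = 0.

(* The inclusion of a submanifold M of N is the identity of the ambient
   space, seen on M. *)
Definition properly_C_harmonic (R : realType) (n : nat)
    (M N : set 'rV[R]_n) : Prop :=
  C_harmonic M N id /\ ~ harmonic 6 M N id.

(* Main.v *)
Require Import Defs.
From mathcomp Require Import all_boot all_order all_algebra.
From mathcomp Require Import all_classical all_reals all_analysis.
From mathcomp Require Import ring lra.

Set Implicit Arguments.
Unset Strict Implicit.
Unset Printing Implicit Defensive.

Import Order.TTheory GRing.Theory Num.Theory numFieldNormedType.Exports.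

Local Open Scope classical_set_scope.
Local Open Scope ring_scope.

(** The proof rests on the fact that a Clifford torus is homogeneous enough for
    the C-harmonic equation to become a polynomial equation in one variable.

    Both the torus and the unit sphere are products of round spheres
    [prod_spheres]: the coordinates are split into groups, and the part of the
    point in the k-th group has norm [r k].  For such a product the tangent
    spaces ([tangent_prod_spheres]), the Levi-Civita connection
    ([nabla_tfield]), the curvature ([curvature_prod_spheres]) and orthonormal
    frames ([orthonormal_reflected_basis]) are explicit.

    Let M be a product of spheres of dimension m contained in the unit sphere,
    with factors of dimensions d_k.  The sections met in the equation all have
    the form p |-> (l_k p_k)_k with constant coefficients l_k, where p_k is the
    component of p in the k-th factor.  On coefficients, [delta d] is
    l |-> (l_k d_k / r_k^2 - sum_j l_j d_j)_k ([divergence_pscale]), S is the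
    multiplication by m ([S_op_pscale]), the scalar curvature is
    sum_k d_k (d_k - 1) / r_k^2 ([scal_prod_spheres]), the tension field has the
    coefficients c_k = d_k / r_k^2 - m, and the last sum of the equation is
    (sum_k c_k d_k) c ([sum_curvature_nabla]).

    For the torus, with s = a^2 and C = n1 - 6 s, the tension field has the
    coefficients C / s and - C / (1 - s).  It is an eigensection of [delta d],
    and dividing the equation by the tension field leaves
      (mu - 6 + 2 Scal / 15) (mu - 6 + Scal / 5) = 2 C^2 / (s (1 - s))
    with mu = n1 (1 - s) / s + n2 s / (1 - s), provided that C is not zero,
    that is, provided that the torus is not minimal.  After multiplication by
    (s (1 - s))^2 the difference of the two sides is the quartic
    [clifford_poly] n1 s, and for each n1 from 1 to 5 it is positive for every
    real s ([clifford_poly_gt0]). *)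

(** * Scalar products and scalings factor by factor *)

Section PartialProduct.
Variables (R : realType) (n : nat) (K : finType) (kap : 'I_n -> K).
Implicit Types (u v w : 'rV[R]_n) (k : K) (l : K -> R).

(** The coordinates are coloured by [kap], and colour [k] spans the k-th factor
    of an orthogonal decomposition of the ambient space.  This is the scalar
    product of the orthogonal projections of [u] and [v] on that factor. *)
Definition factor_dot k u v : R := \sum_(i < n | kap i == k) u 0 i * v 0 i.

(** The maps that act on each factor as a homothety: they contain the
    projections on the factors, and every vector field met below, evaluated at
    a point of a product of spheres, is the image of that point or of a tangent
    vector by such a map. *)
Definition factor_scale l v : 'rV[R]_n := \row_i (l (kap i) * v 0 i).

Local Notation pdot := factor_dot.
Local Notation pscale := factor_scale.

Lemma pscaleE l v i : pscale l v 0 i = l (kap i) * v 0 i.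
Proof. by rewrite mxE. Qed.

Lemma pdotC k u v : pdot k u v = pdot k v u.
Proof. by apply: eq_bigr => i _; rewrite mulrC. Qed.

Lemma pdotDl k u v w : pdot k (u + v) w = pdot k u w + pdot k v w.
Proof. by rewrite -big_split /=; apply: eq_bigr => i _; rewrite mxE mulrDl. Qed.

Lemma pdotNl k u w : pdot k (- u) w = - pdot k u w.
Proof. by rewrite -sumrN; apply: eq_bigr => i _; rewrite mxE mulNr. Qed.

Lemma pdotZl k a u w : pdot k (a *: u) w = a * pdot k u w.
Proof. by rewrite mulr_sumr; apply: eq_bigr => i _; rewrite mxE mulrA. Qed.

Lemma pdot_pscalel k l u w : pdot k (pscale l u) w = l k * pdot k u w.
Proof.
by rewrite mulr_sumr; apply: eq_bigr => i /eqP <-; rewrite pscaleE mulrA.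
Qed.

Lemma pdotDr k u v w : pdot k w (u + v) = pdot k w u + pdot k w v.
Proof. by rewrite pdotC pdotDl !(pdotC k w). Qed.

Lemma pdotNr k u w : pdot k w (- u) = - pdot k w u.
Proof. by rewrite pdotC pdotNl pdotC. Qed.

Lemma pdotZr k a u w : pdot k w (a *: u) = a * pdot k w u.
Proof. by rewrite pdotC pdotZl pdotC. Qed.

Lemma pdot_pscaler k l u w : pdot k w (pscale l u) = l k * pdot k w u.
Proof. by rewrite pdotC pdot_pscalel pdotC. Qed.

Definition pdotE :=
  (pdotDl, pdotDr, pdotNl, pdotNr, pdotZl, pdotZr, pdot_pscalel, pdot_pscaler).

Lemma pdot0l k u : pdot k 0 u = 0.
Proof. by rewrite -(scale0r 0) pdotZl mul0r. Qed.

Lemma pdot_suml k m (F : 'I_m -> 'rV[R]_n) w :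
  pdot k (\sum_i F i) w = \sum_i pdot k (F i) w.
Proof.
elim/big_rec2: _ => [|i x y _ <-]; first exact: pdot0l.
by rewrite pdotDl.
Qed.

Lemma dotp_pdot u v : dotp u v = \sum_k pdot k u v.
Proof. by rewrite /dotp (partition_big kap xpredT). Qed.

Lemma dotp_pscalel l u v : dotp (pscale l u) v = \sum_k l k * pdot k u v.
Proof. by rewrite dotp_pdot; apply: eq_bigr => k _; rewrite pdotE. Qed.

Lemma dotp_delta (i : 'I_n) v : dotp v (delta_mx 0 i) = v 0 i.
Proof.
rewrite /dotp (bigD1 i) //= big1 => [|j ji]; rewrite !mxE !eqxx /=.
  by rewrite mulr1 addr0.
by rewrite (negbTE ji) mulr0.
Qed.

Lemma pdot_delta k i v : pdot k v (delta_mx 0 i) = (kap i == k)%:R * v 0 i.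
Proof.
rewrite /factor_dot big_mkcond (bigD1 i) //= big1 => [|j ji];
  rewrite !mxE !eqxx /=.
  by case: eqP; rewrite ?mulr1 ?mul1r ?mul0r addr0.
by rewrite (negbTE ji) mulr0; case: ifP.
Qed.

Lemma pdot_ge0 k u : 0 <= pdot k u u.
Proof. by apply: sumr_ge0 => i _; rewrite -expr2 sqr_ge0. Qed.

Lemma pdot_eq0 k u : pdot k u u = 0 -> forall i, kap i = k -> u 0 i = 0.
Proof.
move=> /psumr_eq0P u0 i ik; apply/eqP; rewrite -sqrf_eq0 expr2; apply/eqP.
by apply: u0 => [j _|]; rewrite ?ik // -expr2 sqr_ge0.
Qed.

Lemma dotp_eq0 u : dotp u u = 0 -> u = 0.
Proof.
move=> /psumr_eq0P u0; apply/rowP => i; rewrite mxE; apply/eqP.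
rewrite -sqrf_eq0 expr2; apply/eqP.
by apply: u0 => // j _; rewrite -expr2 sqr_ge0.
Qed.

Lemma is_derive_row t (c : R -> 'rV[R]_n) v :
  is_derive t (1 : R) c v <->
  forall i, is_derive t (1 : R) (fun s => c s 0 i) (v 0 i).
Proof.
split=> [[dc <-] i|dc].
  split; first by move/derivable_mxP: dc.
  by rewrite derive_mx // mxE.
have c' : derivable c t 1.
  by apply/derivable_mxP => i j; rewrite ord1; case: (dc j).
split=> //; rewrite derive_mx //; apply/rowP => i; rewrite mxE.
by case: (dc i).
Qed.

Lemma is_derive_pdot k t (c d : R -> 'rV[R]_n) v w :
  is_derive t (1 : R) c v -> is_derive t (1 : R) d w ->
  is_derive t (1 : R) (fun s => pdot k (c s) (d s))
            (pdot k v (d t) + pdot k (c t) w).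
Proof.
move=> /is_derive_row cv /is_derive_row dw.
rewrite -big_split /= (_ : (fun s => _) =
  \sum_(i < n | kap i == k) (fun s => c s 0 i * d s 0 i)); last first.
  by apply/funext => s; rewrite fct_sumE.
elim/big_ind2: _ => [|f df g dg fP gP|i _]; first exact: is_derive_cst.
  exact: is_deriveD.
apply: is_derive_eq (is_deriveM (cv i) (dw i)) _.
by rewrite /= addrC [d t 0 i *: _]mulrC.
Qed.

End PartialProduct.

(** * Tangent spaces of products of round spheres *)

Section ProductOfSpheres.
Variables (R : realType) (n : nat) (K : finType) (kap : 'I_n -> K) (r : K -> R).
Hypothesis r_gt0 : forall k, 0 < r k.
Implicit Types (p q u v w x y z : 'rV[R]_n) (k : K) (l : K -> R).

Local Notation pdot := (factor_dot kap).
Local Notation pscale := (factor_scale kap).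

Definition prod_spheres : set 'rV[R]_n :=
  [set p | forall k, pdot k p p = r k ^+ 2].

Local Notation M := prod_spheres.

Let r_neq0 k : r k != 0.
Proof. by rewrite gt_eqF. Qed.

(** A tangent vector kills the differential of each of the defining equations.
    Conversely, a vector [v] with this property is the velocity of a curve that
    runs, in each factor, along a circle of the sphere of radius [r k] written
    in rational parameters. *)
Lemma tangent_prod_spheres p : M p ->
  tangent M p = [set v | forall k, pdot k v p = 0].
Proof.
move=> Mp; apply/seteqP; split=> [v [c [Mc c0 dc]] k|v vp].
  have := is_derive_pdot kap k dc dc.
  rewrite (_ : (fun s => _) = cst (r k ^+ 2)); last first.
    by apply/funext => s; exact: Mc.
  move=> [_]; rewrite derive_cst c0 [pdot k p v]pdotC => /esym/eqP.
  by rewrite -mulr2n mulrn_eq0 /= => /eqP.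
(* This is the only slope for which the numerator
   (1 - t ^+ 2 * h) *: p + t *: v has norm (1 + t ^+ 2 * h) * r k. *)
pose h k := pdot k v v / (4 * r k ^+ 2).
have h0 k : 0 <= h k.
  by rewrite divr_ge0 ?pdot_ge0// mulr_ge0// sqr_ge0.
have den_neq0 k (t : R) : 1 + t ^+ 2 * h k != 0.
  by rewrite gt_eqF// ltr_pwDl// mulr_ge0// sqr_ge0.
exists (fun t => pscale (fun k => (1 + t ^+ 2 * h k)^-1)
          (pscale (fun k => 1 - t ^+ 2 * h k) p + t *: v)); split.
- move=> t k; rewrite !pdotE [pdot k p v]pdotC vp !Mp.
  have -> : pdot k v v = 4 * r k ^+ 2 * h k.
    by rewrite /h mulrC mulfVK // mulf_neq0// sqrf_eq0.
  by field.
- apply/rowP => i; rewrite pscaleE !mxE expr0n /= !mul0r subr0 addr0 invr1.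
  by rewrite !mul1r addr0.
- apply/is_derive_row => i.
  set k := kap i.
  pose den : R -> R := cst 1 + h k \*: (id ^+ 2).
  pose num : R -> R := p 0 i \*: (cst 1 - h k \*: (id ^+ 2)) + v 0 i \*: id.
  have -> : (fun s => pscale (fun k => (1 + s ^+ 2 * h k)^-1)
        (pscale (fun k => 1 - s ^+ 2 * h k) p + s *: v) 0 i)
      = (fun s => (den s)^-1) * num.
    apply/funext => s.
    transitivity ((1 + h k * s ^+ 2)^-1
                  * (p 0 i * (1 - h k * s ^+ 2) + v 0 i * s)); last by [].
    by rewrite pscaleE !mxE; congr (_^-1 * _); rewrite -/k; ring.
  have dnum : is_derive (0 : R) (1 : R) num (v 0 i).
    apply: is_derive_eq.
    by rewrite /GRing.scale /=; ring.
  have dden : is_derive (0 : R) (1 : R) den 0.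
    apply: is_derive_eq.
    by rewrite /GRing.scale /=; ring.
  have den0 : den 0 = 1.
    transitivity (1 + h k * 0 ^+ 2); first by [].
    by rewrite expr0n mulr0 addr0.
  have den0' : den 0 != 0 by rewrite den0 oner_neq0.
  have dinv : is_derive (0 : R) (1 : R) (fun t => (den t)^-1) 0.
    split; first by apply: derivableV => //; case: dden.
    by rewrite deriveV //; case: dden => _ ->; rewrite scaler0.
  apply: is_derive_eq.
  by rewrite /GRing.scale /= den0 invr1; ring.
Qed.

End ProductOfSpheres.

(** * Derivatives along a submanifold *)

Section TangentialDerivative.
Variables (R : realType) (n : nat) (K : finType) (kap : 'I_n -> K).
Variable M : set 'rV[R]_n.
Implicit Types (F G : 'rV[R]_n -> 'rV[R]_n) (p q v w : 'rV[R]_n).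

(** Differentiability along every curve of [M] with the given velocity: unlike
    the value [tderive], which refers to one chosen curve, it is stable under
    the usual rules of differentiation, and it only depends on the values on
    [M]. *)
Definition has_tderive F p v w : Prop :=
  forall c, curve_through M p v c -> is_derive (0 : R) (1 : R) (F \o c) w.

Lemma tderive_eq F p v w : tangent M p v -> has_tderive F p v w ->
  tderive M F p v = w.
Proof. by move=> /getPex vT dF; case: (dF _ vT). Qed.

Lemma has_tderive_ext F G p v w : (forall q, M q -> F q = G q) ->
  has_tderive G p v w -> has_tderive F p v w.
Proof.
move=> FG dG c cM; rewrite (_ : F \o c = G \o c); first exact: dG.
by apply/funext => t; apply: FG; case: cM.
Qed.

Lemma has_tderive_eq F p v w w' : has_tderive F p v w -> w = w' ->
  has_tderive F p v w'.
Proof. by move=> dF <-. Qed.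

Lemma has_tderive_id p v : has_tderive id p v v.
Proof. by move=> c []. Qed.

Lemma has_tderiveB F G p v w w' : has_tderive F p v w ->
  has_tderive G p v w' -> has_tderive (fun q => F q - G q) p v (w - w').
Proof.
by move=> dF dG c cM; exact: (is_deriveB (dF c cM) (dG c cM)).
Qed.

Lemma has_tderiveN F p v w : has_tderive F p v w ->
  has_tderive (fun q => - F q) p v (- w).
Proof. by move=> dF c cM; exact: (is_deriveN (dF c cM)). Qed.

Lemma has_tderive_cst w p v : has_tderive (fun=> w) p v 0.
Proof. by move=> c _; exact: is_derive_cst. Qed.

Lemma has_tderive_pscale l F p v w : has_tderive F p v w ->
  has_tderive (fun q => factor_scale kap l (F q)) p v (factor_scale kap l w).
Proof.
move=> dF c cM; apply/is_derive_row => i.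
have /is_derive_row/(_ i) dFi := dF c cM.
rewrite (_ : (fun s => _) = l (kap i) \*: (fun s => (F \o c) s 0 i)).
  by rewrite pscaleE; exact: is_deriveZ.
by apply/funext => s; rewrite /= pscaleE.
Qed.

(** Leibniz rule for a field scaled, in each factor, by a linear form of the
    point; the tangential projections and the covariant derivatives of
    projected constant vectors all have this shape. *)
Lemma has_tderive_pdot_pscale l F z p v w : has_tderive F p v w ->
  has_tderive
    (fun q => factor_scale kap (fun k => l k * factor_dot kap k z q) (F q)) p v
    (factor_scale kap (fun k => l k * factor_dot kap k z v) (F p)
     + factor_scale kap (fun k => l k * factor_dot kap k z p) w).
Proof.
move=> dF c cM; apply/is_derive_row => i.
have /is_derive_row/(_ i) dFi := dF c cM.
case: (cM) => [_ c0 dc].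
have dz := is_derive_pdot kap (kap i) (is_derive_cst z (0 : R) (1 : R)) dc.
rewrite pdot0l add0r /= in dz.
rewrite (_ : (fun s => _) = l (kap i) \*:
  ((fun s => factor_dot kap (kap i) z (c s)) * (fun s => (F \o c) s 0 i)));
  last first.
  by apply/funext => s; rewrite /= pscaleE -mulrA.
apply: is_derive_eq (is_deriveZ _ (is_deriveM dz dFi)) _.
by rewrite mxE !pscaleE /GRing.scale /= c0; ring.
Qed.

End TangentialDerivative.

(** * Levi-Civita connection and curvature of products of spheres *)

Section Connection.
Variables (R : realType) (n : nat) (K : finType) (kap : 'I_n -> K) (r : K -> R).
Hypothesis r_gt0 : forall k, 0 < r k.
Implicit Types (p q u v w x y z : 'rV[R]_n) (k : K) (l : K -> R).

Local Notation pdot := (factor_dot kap).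
Local Notation pscale := (factor_scale kap).
Local Notation M := (prod_spheres kap r).

Let r_neq0 k : r k != 0.
Proof. by rewrite gt_eqF. Qed.

Lemma tangent_pdot p v : M p -> tangent M p v -> forall k, pdot k v p = 0.
Proof. by move=> Mp; rewrite tangent_prod_spheres. Qed.

Lemma pdot_tangent p v : M p -> (forall k, pdot k v p = 0) -> tangent M p v.
Proof. by move=> Mp; rewrite tangent_prod_spheres. Qed.

(** Orthogonal projection on the tangent space: in each factor it removes the
    component along the radial direction. *)
Definition tanproj q v : 'rV[R]_n :=
  v - pscale (fun k => (r k ^+ 2)^-1 * pdot k v q) q.

Lemma tanproj_tangent p v : M p -> tangent M p v -> tanproj p v = v.
Proof.
move=> Mp /(tangent_pdot Mp) vp; apply/rowP => i.
by rewrite !mxE vp mulr0 mul0r subr0.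
Qed.

Lemma tangent_tanproj p v : M p -> tangent M p (tanproj p v).
Proof.
move=> Mp; apply: pdot_tangent => // k.
by rewrite !pdotE Mp mulrAC mulVf ?mul1r ?subrr// sqrf_eq0.
Qed.

Lemma oproj_prod_spheres p v : M p -> oproj (tangent M p) v = tanproj p v.
Proof.
move=> Mp; apply: get_unique.
  split; first exact: tangent_tanproj.
  move=> z /(tangent_pdot Mp) zp; rewrite /tanproj opprB addrC subrK.
  rewrite (dotp_pscalel kap) big1 // => k _.
  by rewrite [pdot k p z]pdotC zp mulr0.
move=> w [wT wz]; apply/eqP; rewrite -subr_eq0; apply/eqP/dotp_eq0.
set d := w - _.
have dT : tangent M p d.
  apply: pdot_tangent => // k; rewrite /d pdotDl pdotNl (tangent_pdot Mp wT).
  by rewrite (tangent_pdot Mp (tangent_tanproj v Mp)) subr0.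
have dp := tangent_pdot Mp dT.
have -> : dotp d d = - dotp (v - w) d + dotp (v - tanproj p v) d.
  by rewrite /dotp -sumrN -big_split; apply: eq_bigr => i _;
    rewrite /d !mxE /=; ring.
rewrite wz // oppr0 add0r /tanproj opprB addrC subrK (dotp_pscalel kap).
by rewrite big1 // => k _; rewrite [pdot k p d]pdotC dp mulr0.
Qed.

Lemma tfield_prod_spheres p v : M p -> tfield M v p = tanproj p v.
Proof. exact: oproj_prod_spheres. Qed.

Lemma tfield_tangent p v : M p -> tangent M p v -> tfield M v p = v.
Proof. by move=> Mp vT; rewrite tfield_prod_spheres // tanproj_tangent. Qed.

(** The two terms come from differentiating the radial component and the
    radial direction; the first one is normal to [M], hence disappears in
    covariant derivatives. *)
Lemma has_tderive_tfield p v z : M p -> has_tderive M (tfield M z) p v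
  (- (pscale (fun k => (r k ^+ 2)^-1 * pdot k z v) p
     + pscale (fun k => (r k ^+ 2)^-1 * pdot k z p) v)).
Proof.
move=> Mp; apply: (@has_tderive_ext _ _ M _
  (fun q => z - pscale (fun k => (r k ^+ 2)^-1 * pdot k z q) q)).
  by move=> q Mq; exact: tfield_prod_spheres.
rewrite -[X in has_tderive _ _ _ _ X]sub0r; apply: has_tderiveB.
  exact: has_tderive_cst.
exact: has_tderive_pdot_pscale (@has_tderive_id _ _ M p v).
Qed.

Lemma tanproj_normal p l : M p -> tanproj p (pscale l p) = 0.
Proof.
move=> Mp; apply/rowP => i.
rewrite !mxE pdotE Mp; field; exact: r_neq0.
Qed.

Lemma tanprojD p u v : tanproj p (u + v) = tanproj p u + tanproj p v.
Proof. by apply/rowP => i; rewrite !mxE pdotDl; ring. Qed.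

Lemma tanprojN p u : tanproj p (- u) = - tanproj p u.
Proof. by apply/rowP => i; rewrite !mxE pdotNl; ring. Qed.

Lemma tangent_pscale p l v : M p -> tangent M p v -> tangent M p (pscale l v).
Proof.
move=> Mp /(tangent_pdot Mp) vp; apply: pdot_tangent => // k.
by rewrite pdotE vp mulr0.
Qed.

(** At [p] itself the right-hand side vanishes when [z] is tangent, but as a
    function of [p] it does not: its derivative gives the curvature. *)
Lemma nabla_tfield p v z : M p -> tangent M p v ->
  nabla M (tfield M z) p v
  = - pscale (fun k => (r k ^+ 2)^-1 * pdot k z p) v.
Proof.
move=> Mp vT; rewrite /nabla /covd /= oproj_prod_spheres //.
rewrite (tderive_eq vT (has_tderive_tfield z Mp)).
rewrite tanprojN tanprojD tanproj_normal // add0r tanproj_tangent //.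
exact: tangent_pscale.
Qed.

Lemma lie_bracket_tfield p x y : M p -> tangent M p x -> tangent M p y ->
  lie_bracket M (tfield M x) (tfield M y) p = 0.
Proof.
move=> Mp xT yT; rewrite /lie_bracket !tfield_tangent //.
rewrite (tderive_eq xT (has_tderive_tfield y Mp)).
rewrite (tderive_eq yT (has_tderive_tfield x Mp)).
have xp := tangent_pdot Mp xT; have yp := tangent_pdot Mp yT.
by apply/rowP => i; rewrite !mxE xp yp [pdot _ y x]pdotC; ring.
Qed.

Lemma nabla_nabla_tfield p x y z :
  M p -> tangent M p x -> tangent M p y -> tangent M p z ->
  nabla M (fun q => nabla M (tfield M z) q (tfield M y q)) p x
  = - pscale (fun k => (r k ^+ 2)^-1 * pdot k z x) y.
Proof.
move=> Mp xT yT zT; rewrite {1}/nabla /covd /= oproj_prod_spheres //.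
rewrite (tderive_eq (w := - pscale (fun k => (r k ^+ 2)^-1 * pdot k z x) y) xT).
  rewrite tanprojN tanproj_tangent //; exact: tangent_pscale.
apply: (@has_tderive_ext _ _ M _ (fun q => - pscale
    (fun k => (r k ^+ 2)^-1 * pdot k z q) (tfield M y q))) => [q Mq|].
  rewrite nabla_tfield // tfield_prod_spheres //; exact: tangent_tanproj.
apply: has_tderiveN.
have zp := tangent_pdot Mp zT.
have dF := has_tderive_pdot_pscale kap (fun k => (r k ^+ 2)^-1) z
  (has_tderive_tfield y Mp (v := x)).
move: dF; set W := (X in has_tderive _ _ _ _ X -> _) => dF.
apply: (has_tderive_eq dF); rewrite /W {dF W}.
by rewrite tfield_tangent //; apply/rowP => i; rewrite !mxE zp; ring.
Qed.

(** The curvature of a product is the sum of those of the factors, and the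
    k-th factor has constant curvature [(r k)^-2]. *)
Lemma curvature_prod_spheres p x y z :
  M p -> tangent M p x -> tangent M p y -> tangent M p z ->
  curvature M p x y z
  = pscale (fun k => (r k ^+ 2)^-1 * pdot k y z) x
    - pscale (fun k => (r k ^+ 2)^-1 * pdot k x z) y.
Proof.
move=> Mp xT yT zT; rewrite /curvature lie_bracket_tfield // !tfield_tangent //.
have T0 : tangent M p 0 by apply: pdot_tangent => // k; rewrite pdot0l.
transitivity (- pscale (fun k => (r k ^+ 2)^-1 * pdot k z x) y
  - (- pscale (fun k => (r k ^+ 2)^-1 * pdot k z y) x)
  - (- pscale (fun k => (r k ^+ 2)^-1 * pdot k z p) 0)).
  congr (_ - _ - _); first exact: nabla_nabla_tfield.
    exact: nabla_nabla_tfield.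
  exact: nabla_tfield.
by apply/rowP => i; rewrite !mxE ![pdot _ z _]pdotC; ring.
Qed.

End Connection.

(** * Orthonormal frames of products of spheres *)

Section Frames.
Variables (R : realType) (n m : nat) (K : finType) (kap : 'I_n -> K).
Variable r : K -> R.
Hypothesis r_gt0 : forall k, 0 < r k.
Variable base : K -> 'I_n.
Hypothesis kap_base : cancel base kap.
Hypothesis card_m : (m + #|K| = n)%N.
Implicit Types (p q u v w x y z : 'rV[R]_n) (k : K) (l : K -> R).

Local Notation pdot := (factor_dot kap).
Local Notation pscale := (factor_scale kap).
Local Notation M := (prod_spheres kap r).

Let r_neq0 k : r k != 0.
Proof. by rewrite gt_eqF. Qed.

(** The point whose k-th component is [r k] times the coordinate vector number
    [base k]: there the remaining coordinate vectors form an orthonormal basis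
    of the tangent space. *)
Definition base_point : 'rV[R]_n :=
  \row_i (if i == base (kap i) then r (kap i) else 0).

Lemma pdot_base_point k v : pdot k v base_point = r k * v 0 (base k).
Proof.
rewrite /base_point /factor_dot (bigD1 (base k)) ?kap_base//=.
rewrite big1 => [|i /andP[/eqP ik ib]].
  by rewrite mxE kap_base eqxx addr0 mulrC.
by rewrite mxE ik (negbTE ib) mulr0.
Qed.

Lemma base_point_in : M base_point.
Proof. by move=> k; rewrite pdot_base_point mxE kap_base eqxx expr2. Qed.

(** In each factor, the Householder reflection that exchanges the components of
    [p] and of the base point.  When these coincide, [w] has no component in
    the factor and the formula, with its quotient by zero, is the identity. *)
Definition reflection p v : 'rV[R]_n :=
  let w := p - base_point in
  v - pscale (fun k => 2 * pdot k v w / pdot k w w) w.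

Lemma pdot_reflection p k u v :
  pdot k (reflection p u) (reflection p v) = pdot k u v.
Proof.
rewrite /reflection; move: (p - _) => w; rewrite !pdotE [pdot k w v]pdotC.
have [->|w0] := eqVneq (pdot k w w) 0; first by rewrite !invr0; ring.
by field.
Qed.

Lemma reflectionK p : involutive (reflection p).
Proof.
move=> v; apply/rowP => i; rewrite /reflection; move: (p - _) => w.
rewrite !mxE !pdotE; set k := kap i.
have [->|w0] := eqVneq (pdot k w w) 0; first by rewrite !invr0; ring.
by field.
Qed.

Lemma reflection_point p : M p -> reflection p p = base_point.
Proof.
move=> Mp; apply/rowP => i; rewrite /reflection.
have [w wE] : exists w, w = p - base_point by exists (p - base_point).
rewrite -wE !mxE; set k := kap i.
have ww : pdot k w w = 2 * pdot k p w.
  have := base_point_in k.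
  rewrite wE !pdotE [pdot k base_point p]pdotC !Mp => ->; ring.
have [w0|w0] := eqVneq (pdot k w w) 0.
  have := pdot_eq0 w0 (erefl : kap i = k).
  by rewrite w0 invr0 mulr0 mul0r subr0 wE !mxE => /eqP;
    rewrite subr_eq0 => /eqP.
by rewrite -ww divff // mul1r wE !mxE -/k; ring.
Qed.

Lemma reflection_base_point p : M p -> reflection p base_point = p.
Proof. by move=> Mp; rewrite -(reflection_point Mp) reflectionK. Qed.

(** Linearity in the form used to transport expansions in a basis. *)
Lemma reflection_sum p m' (F : 'I_m' -> 'rV[R]_n) (c : 'I_m' -> R) :
  reflection p (\sum_i c i *: F i) = \sum_i c i *: reflection p (F i).
Proof.
rewrite /reflection; move: (p - _) => w; apply/rowP => j.
rewrite !(mxE, summxE) pdot_suml mulr_sumr !mulr_suml -sumrB.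
by apply: eq_bigr => i _; rewrite !mxE pdotE; ring.
Qed.

Let nonbase := [pred i : 'I_n | i != base (kap i)].

Lemma card_nonbase : #|nonbase| = m.
Proof.
have cb : #|codom base| = #|K| by apply: card_codom (can_inj kap_base).
have : (#|K| + #|[predC codom base]| = #|K| + m)%N.
  by rewrite [RHS]addnC card_m -cb cardC card_ord.
move=> /addnI <-.
apply: eq_card => i; rewrite !inE; congr (~~ _).
by apply/eqP/codomP => [->|[k ->]]; [exists (kap i)|rewrite kap_base].
Qed.

Definition nonbase_index (i : 'I_m) : 'I_n :=
  enum_val (cast_ord (esym card_nonbase) i).

Definition reflected_basis p (i : 'I_m) : 'rV[R]_n :=
  reflection p (delta_mx 0 (nonbase_index i)).

(** The reflection is an isometry that maps the base point to [p], so it maps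
    the obvious basis at the base point to one at [p].  In particular [frame],
    which is defined by a choice, is a genuine orthonormal frame. *)
Lemma orthonormal_reflected_basis p : M p ->
  orthonormal_basis (tangent M p) (reflected_basis p).
Proof.
move=> Mp; split=> [i|i j|v vT].
- apply: pdot_tangent => // k; rewrite /reflected_basis.
  rewrite -{2}(reflection_base_point Mp) pdot_reflection pdotC pdot_delta.
  have := enum_valP (cast_ord (esym card_nonbase) i).
  by rewrite inE mxE => /negbTE ->; rewrite mulr0.
- rewrite (dotp_pdot kap).
  under eq_bigr do rewrite pdot_reflection.
  rewrite -dotp_pdot dotp_delta mxE eqxx /= (inj_eq enum_val_inj).
  by rewrite (inj_eq (@cast_ord_inj _ _ _)) eq_sym.
- rewrite -{1}(reflectionK p v).
  have -> : reflection p v = \sum_(i < m) dotp v (reflected_basis p i) *: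
      (delta_mx 0 (nonbase_index i) : 'rV_n).
    rewrite [LHS]row_sum_delta.
    transitivity (\sum_(j in nonbase) reflection p v 0 j *:
        (delta_mx 0 j : 'rV_n)).
      rewrite [RHS]big_mkcond; apply: eq_bigr => j _; rewrite inE.
      case: eqP => // jb.
      suff -> : reflection p v 0 j = 0 by rewrite scale0r.
      apply: (mulfI (r_neq0 (kap j))); rewrite mulr0 {2}jb -pdot_base_point.
      rewrite -(reflection_point Mp) pdot_reflection.
      exact: (tangent_pdot r_gt0 Mp vT).
    rewrite (big_enum_val (A := nonbase)).
    rewrite (reindex (cast_ord (esym card_nonbase))); last first.
      by apply: onW_bij; exists (cast_ord card_nonbase) => i;
        rewrite ?cast_ordK ?cast_ordKV.
    apply: eq_bigr => i _; rewrite (dotp_pdot kap).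
    under [in RHS]eq_bigr do rewrite -{1}(reflectionK p v) pdot_reflection.
    by rewrite -dotp_pdot dotp_delta.
  by rewrite reflection_sum.
Qed.

End Frames.

(** * The unit sphere as a product with one factor *)

Section UnitSphere.
Variables (R : realType) (n : nat).
Implicit Types (p v x y z : 'rV[R]_n).

Local Notation N := (unit_sphere R n).
Local Notation one_factor := (fun _ : 'I_n => tt).

Lemma pdot_one_factor k u v : factor_dot one_factor k u v = dotp u v :> R.
Proof. by case: k; apply: eq_bigl => i; exact: eqxx. Qed.

Lemma unit_sphereE : N = prod_spheres one_factor (fun=> 1).
Proof.
apply/seteqP; split => p; rewrite /unit_sphere /prod_spheres /=.
  move=> p1 k; rewrite pdot_one_factor -p1 sqr_sqrtr //.
  by rewrite -(pdot_one_factor tt) pdot_ge0.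
by move=> /(_ tt); rewrite pdot_one_factor /enorm => ->; rewrite expr1n sqrtr1.
Qed.

Lemma tangent_unit_sphere p v : N p -> tangent N p v <-> dotp v p = 0.
Proof.
rewrite unit_sphereE => Np; rewrite tangent_prod_spheres //=.
by split=> [/(_ tt)|vp k]; rewrite pdot_one_factor.
Qed.

Lemma oproj_unit_sphere p v : N p ->
  oproj (tangent N p) v = v - dotp v p *: p.
Proof.
rewrite unit_sphereE => Np; rewrite oproj_prod_spheres //.
by apply/rowP => i; rewrite !mxE pdot_one_factor expr1n invr1 mul1r.
Qed.

Lemma curvature_unit_sphere p x y z :
  N p -> tangent N p x -> tangent N p y -> tangent N p z ->
  curvature N p x y z = dotp y z *: x - dotp x z *: y.
Proof.
rewrite unit_sphereE => Np xT yT zT; rewrite curvature_prod_spheres //.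
by apply/rowP => i; rewrite !mxE !pdot_one_factor expr1n invr1 !mul1r.
Qed.

End UnitSphere.

(** * Products of spheres inside the unit sphere *)

Section ProductInSphere.
Variables (R : realType) (n m : nat) (K : finType) (kap : 'I_n -> K).
Variable r : K -> R.
Hypothesis r_gt0 : forall k, 0 < r k.
Hypothesis sum_r : \sum_k r k ^+ 2 = 1.
Variable base : K -> 'I_n.
Hypothesis kap_base : cancel base kap.
Hypothesis card_m : (m + #|K| = n)%N.
Implicit Types (p q u v w x y z : 'rV[R]_n) (k : K) (l : K -> R).

Local Notation pdot := (factor_dot kap).
Local Notation pscale := (factor_scale kap).
Local Notation M := (prod_spheres kap r).
Local Notation N := (unit_sphere R n).

Let r_neq0 k : r k != 0.
Proof. by rewrite gt_eqF. Qed.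

Lemma prod_spheres_dotp p : M p -> dotp p p = 1.
Proof.
by move=> Mp; rewrite (dotp_pdot kap) -sum_r; apply: eq_bigr => k _; exact: Mp.
Qed.

Lemma prod_spheres_sub p : M p -> N p.
Proof.
by move=> Mp; rewrite /unit_sphere /= /enorm prod_spheres_dotp // sqrtr1.
Qed.

Lemma dotp_pscale_tangent p l v : M p -> tangent M p v ->
  dotp (pscale l p) v = 0.
Proof.
move=> Mp vT; rewrite (dotp_pscalel kap) big1 // => k _.
by rewrite pdotC (tangent_pdot r_gt0 Mp vT) mulr0.
Qed.

Lemma dotp_pscale_point p l : M p ->
  dotp (pscale l p) p = \sum_k l k * r k ^+ 2.
Proof.
by move=> Mp; rewrite (dotp_pscalel kap); apply: eq_bigr => k _; rewrite Mp.
Qed.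

Lemma tangent_sub p v : M p -> tangent M p v -> tangent N p v.
Proof.
move=> Mp vT; apply/(tangent_unit_sphere _ (prod_spheres_sub Mp)).
rewrite (dotp_pdot kap) big1 // => k _.
by rewrite (tangent_pdot r_gt0 Mp vT).
Qed.

Lemma tangent_normal_section p l : M p -> \sum_k l k * r k ^+ 2 = 0 ->
  tangent N p (pscale l p).
Proof.
move=> Mp l0; apply/(tangent_unit_sphere _ (prod_spheres_sub Mp)).
by rewrite dotp_pscale_point.
Qed.

Lemma orthonormal_frame p : M p ->
  orthonormal_basis (tangent M p) (frame M p : 'I_m -> _).
Proof.
move=> Mp; apply: getPex; exists (reflected_basis r kap_base card_m p).
exact: orthonormal_reflected_basis.
Qed.

(** The dimension of the k-th sphere. *)
Definition factor_dim k : R := #|[pred i | kap i == k]|%:R - 1.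
Local Notation d := factor_dim.

Section OrthonormalBasis.
Variables (p : 'rV[R]_n) (e : 'I_m -> 'rV[R]_n).
Hypothesis Mp : M p.
Hypothesis eP : orthonormal_basis (tangent M p) e.

Let e_tangent i : tangent M p (e i).
Proof. by case: eP. Qed.

(** The trace, over the tangent space, of the projection on the k-th factor.
    It is read off in the ambient coordinates: [coord] expands the tangential
    projection of a coordinate vector in the basis [e]. *)
Lemma sum_pdot_basis k : \sum_i pdot k (e i) (e i) = d k.
Proof.
case: eP => _ _ span.
have coord j : \sum_i e i 0 j * e i 0 j
    = 1 - (r (kap j) ^+ 2)^-1 * (p 0 j * p 0 j).
  have /rowP/(_ j) := span _ (tangent_tanproj r_gt0 (delta_mx 0 j) Mp).
  rewrite summxE => sE; transitivity (tanproj kap r p (delta_mx 0 j) 0 j).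
    rewrite sE; apply: eq_bigr => i _; rewrite mxE; congr (_ * _).
    rewrite /tanproj (dotp_pdot kap).
    under eq_bigr do rewrite pdotDl pdotNl.
    rewrite big_split /= sumrN -!dotp_pdot dotp_pscale_tangent // subr0.
    rewrite -(dotp_delta j (e i)) (dotp_pdot kap) [RHS](dotp_pdot kap).
    by apply: eq_bigr => k' _; rewrite pdotC.
  by rewrite !mxE !eqxx pdotC pdot_delta eqxx mul1r mulrA.
rewrite exchange_big /=.
under eq_bigr do rewrite coord.
rewrite big_split /= sumr_const /factor_dim; congr (_ + _).
rewrite (eq_bigr (fun j => - (r k ^+ 2)^-1 * (p 0 j * p 0 j))); last first.
  by move=> j /eqP ->; rewrite mulNr.
by rewrite -mulr_sumr [X in _ * X]Mp mulNr mulVf // sqrf_eq0.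
Qed.

(** Parseval's identity for the component of [e i] in the k-th factor, which
    is again a tangent vector. *)
Lemma sum_pdot_sqr k i : \sum_j pdot k (e i) (e j) ^+ 2 = pdot k (e i) (e i).
Proof.
case: eP => _ _ span.
pose u := pscale (fun k' => (k' == k)%:R) (e i).
have uE v : dotp u v = pdot k (e i) v.
  rewrite (dotp_pscalel kap) (bigD1 k) //= eqxx mul1r big1 ?addr0 // => k' k'k.
  by rewrite (negbTE k'k) mul0r.
transitivity (pdot k u (e i)); last by rewrite pdotE eqxx mul1r.
rewrite [X in pdot k X _](span u) ?pdot_suml; last exact: tangent_pscale.
by apply: eq_bigr => j _; rewrite pdotZl uE [pdot k (e j) _]pdotC expr2.
Qed.

End OrthonormalBasis.

Lemma scal_prod_spheres p : M p ->
  scal m M p = \sum_k (r k ^+ 2)^-1 * (d k ^+ 2 - d k).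
Proof.
move=> Mp; rewrite /scal; have := orthonormal_frame Mp.
move: (frame M p) => e eP.
have eT i : tangent M p (e i) by case: eP.
transitivity (\sum_i \sum_j \sum_k (r k ^+ 2)^-1 *
    (pdot k (e j) (e j) * pdot k (e i) (e i) - pdot k (e i) (e j) ^+ 2)).
  apply: eq_bigr => i _; apply: eq_bigr => j _.
  rewrite (curvature_prod_spheres r_gt0 Mp) // (dotp_pdot kap).
  apply: eq_bigr => k _; rewrite !pdotE [pdot k (e j) (e i)]pdotC; ring.
under eq_bigr do rewrite exchange_big /=.
rewrite exchange_big /=; apply: eq_bigr => k _.
under eq_bigr do rewrite -mulr_sumr.
rewrite -mulr_sumr; congr (_ * _).
under eq_bigr do
  rewrite sumrB -mulr_suml (sum_pdot_basis Mp eP) (sum_pdot_sqr Mp eP).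
by rewrite sumrB -mulr_sumr (sum_pdot_basis Mp eP) expr2.
Qed.

(** The image of [v] by the homotheties is already tangent to the sphere: it is
    orthogonal to [p] factor by factor. *)
Lemma covd_pscale V l p v : (forall q, M q -> V q = pscale l q) ->
  M p -> tangent M p v -> covd M N id V p v = pscale l v.
Proof.
move=> VE Mp vT; rewrite /covd oproj_unit_sphere; last exact: prod_spheres_sub.
have dV : has_tderive M V p v (pscale l v).
  apply: has_tderive_ext VE _.
  exact: has_tderive_pscale (@has_tderive_id _ _ M p v).
rewrite (tderive_eq vT dV) (_ : dotp _ _ = 0) ?scale0r ?subr0 //.
rewrite (dotp_pscalel kap) big1 // => k _.
by rewrite (tangent_pdot r_gt0 Mp vT) mulr0.
Qed.

Lemma tderive_id p v : tangent M p v -> tderive M id p v = v.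
Proof. by move=> vT; exact: tderive_eq vT (@has_tderive_id _ _ M p v). Qed.

(** The coefficients of [delta d] applied to the section with coefficients [l];
    with [l = 1] they are those of the tension field. *)
Definition rough_coef l k : R := l k * d k / r k ^+ 2 - \sum_j l j * d j.

(** Tangent fields extended by projection have zero covariant derivative at
    [p], so only the second fundamental form contributes: the derivative of
    [tfield M (e i)] along [e i] is minus the radial vector of each factor
    weighted by [pdot k (e i) (e i) / r k ^+ 2].  The subtracted sum is the
    projection on the tangent space of the unit sphere. *)
Lemma divergence_pscale alpha l p :
  (forall q v, M q -> tangent M q v -> alpha q v = pscale l v) -> M p ->
  divergence m M N id alpha p = pscale (rough_coef l) p.
Proof.
move=> alphaE Mp; rewrite /divergence; have := orthonormal_frame Mp.
move: (frame M p) => e eP.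
have eT i : tangent M p (e i) by case: eP.
transitivity (- \sum_i ((\sum_k l k * pdot k (e i) (e i)) *: p
   - pscale (fun k => l k / r k ^+ 2 * pdot k (e i) (e i)) p)).
  congr (- _); apply: eq_bigr => i _.
  have ep := tangent_pdot r_gt0 Mp (eT i).
  have -> : nabla M (tfield M (e i)) p (e i) = 0.
    rewrite nabla_tfield //; apply/rowP => j.
    by rewrite !mxE ep; ring.
  have T0 : tangent M p 0 by apply: pdot_tangent => // k; rewrite pdot0l.
  rewrite (alphaE _ _ Mp T0) (_ : pscale l 0 = 0) ?subr0; last first.
    by apply/rowP => j; rewrite !mxE mulr0.
  rewrite /covd oproj_unit_sphere; last exact: prod_spheres_sub.
  rewrite (tderive_eq (w := - pscale
    (fun k => l k / r k ^+ 2 * pdot k (e i) (e i)) p) (eT i)).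
    rewrite addrC -scaleNr; congr (_ *: _ + _).
    rewrite (dotp_pdot kap) -sumrN; apply: eq_bigr => k _.
    by rewrite pdotNl pdotE Mp; field.
  apply: (@has_tderive_ext _ _ M _
    (fun q => pscale l (tfield M (e i) q))) => [q Mq|].
    rewrite alphaE // tfield_prod_spheres //; exact: tangent_tanproj.
  apply: has_tderive_eq (has_tderive_pscale kap l
    (has_tderive_tfield r_gt0 (e i) Mp (v := e i))) _.
  by apply/rowP => j; rewrite !mxE ep; ring.
apply/rowP => j; rewrite !(mxE, summxE).
rewrite (eq_bigr (fun i => (\sum_k l k * pdot k (e i) (e i)) * p 0 j
   - l (kap j) / r (kap j) ^+ 2 * p 0 j * pdot (kap j) (e i) (e i)));
  last first.
  by move=> i _; rewrite !mxE; ring.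
rewrite sumrB -mulr_suml -mulr_sumr exchange_big /=.
under eq_bigr do rewrite -mulr_sumr (sum_pdot_basis Mp eP).
by rewrite (sum_pdot_basis Mp eP) /rough_coef; ring.
Qed.

(** For [X] normal to [M] in the unit sphere, each summand is [X] because [e i]
    is a unit vector orthogonal to [X]. *)
Lemma S_op_pscale X l p : \sum_k l k * r k ^+ 2 = 0 -> X p = pscale l p ->
  M p -> S_op m M N id X p = m%:R *: pscale l p.
Proof.
move=> l0 XE Mp; rewrite /S_op; have := orthonormal_frame Mp.
move: (frame M p) => e [eT orth _].
rewrite (eq_bigr (fun=> pscale l p)).
  by rewrite sumr_const card_ord scaler_nat.
move=> i _; rewrite tderive_id // XE curvature_unit_sphere //; first last.
- exact: tangent_sub.
- exact: tangent_sub.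
- exact: tangent_normal_section.
- exact: prod_spheres_sub.
by rewrite orth eqxx scale1r dotp_pscale_tangent // scale0r subr0.
Qed.

Definition dS_coef (f : R) l k : R := rough_coef l k - m%:R * l k + f * l k.

(** The operators of the C-harmonic equation preserve the sections of the form
    [pscale l p] that are tangent to the unit sphere, so that the equation
    becomes one on coefficients. *)
Lemma dS_op_pscale f V l p : \sum_k l k * r k ^+ 2 = 0 ->
  (forall q, M q -> V q = pscale l q) -> M p ->
  dS_op m M N id f V p = pscale (dS_coef (f p) l) p.
Proof.
move=> l0 VE Mp; rewrite /dS_op (S_op_pscale l0 (VE p Mp) Mp).
rewrite (@divergence_pscale _ l) //; last first.
  by move=> q v Mq vT; exact: covd_pscale.
by rewrite (VE p Mp); apply/rowP => i; rewrite !mxE /dS_coef; ring.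
Qed.

Lemma rough_coef_normal l : \sum_k rough_coef l k * r k ^+ 2 = 0.
Proof.
rewrite /rough_coef.
under eq_bigr do rewrite mulrBl divfK ?sqrf_eq0 //.
by rewrite sumrB -mulr_sumr sum_r mulr1 subrr.
Qed.

Lemma dS_coef_normal f l : \sum_k l k * r k ^+ 2 = 0 ->
  \sum_k dS_coef f l k * r k ^+ 2 = 0.
Proof.
move=> l0; rewrite /dS_coef.
rewrite (eq_bigr (fun k => rough_coef l k * r k ^+ 2
  + (f - m%:R) * (l k * r k ^+ 2))); last by move=> k _; ring.
by rewrite big_split /= -mulr_sumr l0 mulr0 addr0 rough_coef_normal.
Qed.

Definition tension_coef := rough_coef (fun=> 1).

Lemma delta_T_prod_spheres p : M p ->
  delta_T m M N id p = pscale tension_coef p.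
Proof.
move=> Mp; apply: divergence_pscale => // q v Mq vT; rewrite tderive_id //.
by apply/rowP => i; rewrite mxE mul1r.
Qed.

Lemma sum_curvature_nabla V l p : \sum_k l k * r k ^+ 2 = 0 ->
  (forall q, M q -> V q = pscale l q) -> M p ->
  let e := @frame R n m M p in
  \sum_(i < m) curvature N (id p) (V p) (tderive M id p (e i))
                 (covd M N id V p (e i))
  = (\sum_k l k * d k) *: pscale l p.
Proof.
move=> l0 VE Mp /=; have := orthonormal_frame Mp.
move: (frame M p) => e eP; have eT i : tangent M p (e i) by case: eP.
transitivity (\sum_i (\sum_k l k * pdot k (e i) (e i)) *: pscale l p).
  apply: eq_bigr => i _; rewrite tderive_id // (covd_pscale VE) // VE //.
  have lT : tangent M p (pscale l (e i)) by exact: tangent_pscale.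
  rewrite curvature_unit_sphere //; first last.
  - exact: tangent_sub.
  - exact: tangent_sub.
  - exact: tangent_normal_section.
  - exact: prod_spheres_sub.
  rewrite dotp_pscale_tangent // scale0r subr0; congr (_ *: _).
  by rewrite (dotp_pdot kap); apply: eq_bigr => k _; rewrite pdotE.
rewrite -scaler_suml exchange_big /=; congr (_ *: _).
by apply: eq_bigr => k _; rewrite -mulr_sumr (sum_pdot_basis Mp eP).
Qed.

Lemma pscale_eq0 p l : M p -> pscale l p = 0 -> forall k, l k = 0.
Proof.
move=> Mp lp k; have := pdot_pscalel kap k l p p.
rewrite lp pdot0l Mp => /esym/eqP.
by rewrite mulf_eq0 sqrf_eq0 (negbTE (r_neq0 k)) orbF => /eqP.
Qed.

End ProductInSphere.

(** * The C-harmonic equation on coefficients *)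

Section CHarmonicProduct.
Variables (R : realType) (n : nat) (K : finType) (kap : 'I_n -> K).
Variable r : K -> R.
Hypothesis r_gt0 : forall k, 0 < r k.
Hypothesis sum_r : \sum_k r k ^+ 2 = 1.
Variable base : K -> 'I_n.
Hypothesis kap_base : cancel base kap.
Hypothesis card_6 : (6 + #|K| = n)%N.

Local Notation M := (prod_spheres kap r).
Local Notation N := (unit_sphere R n).
Local Notation d := (factor_dim R kap).
Local Notation c := (tension_coef kap r).

Lemma harmonic_prod_spheres : (forall k, c k = 0) -> Defs.harmonic 6 M N id.
Proof.
move=> c0 p Mp; rewrite (delta_T_prod_spheres r_gt0 sum_r kap_base card_6) //.
by apply/rowP => i; rewrite !mxE c0 mul0r.
Qed.

(** No component of a point of [M] vanishes, so that the equation at a single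
    point gives an equation for each coefficient. *)
Lemma C_harmonic_prod_spheres : C_harmonic M N id ->
  let s := \sum_k (r k ^+ 2)^-1 * (d k ^+ 2 - d k) in
  forall k, dS_coef 6 kap r (2 * s / 15) (dS_coef 6 kap r (s / 5) c) k
    - 2 * (\sum_j c j * d j) * c k = 0.
Proof.
move=> harm s.
have Mb : M (base_point kap r base) by exact: base_point_in.
have tauE q : M q -> delta_T 6 M N id q = factor_scale kap c q.
  by move=> Mq; rewrite (delta_T_prod_spheres r_gt0 sum_r kap_base card_6).
have c0 : \sum_k c k * r k ^+ 2 = 0 by exact: rough_coef_normal.
have scalE q : M q -> scal 6 M q = s.
  by move=> Mq; rewrite (scal_prod_spheres r_gt0 kap_base card_6).
have innerE q : M q -> dS_op 6 M N id (fun q => scal 6 M q / 5)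
    (delta_T 6 M N id) q = factor_scale kap (dS_coef 6 kap r (s / 5) c) q.
  move=> Mq; rewrite (dS_op_pscale r_gt0 sum_r kap_base card_6 _ c0) //.
  by rewrite scalE.
apply: (pscale_eq0 r_gt0 Mb); rewrite -[RHS](harm _ Mb).
transitivity (
    factor_scale kap
      (dS_coef 6 kap r (2 * scal 6 M (base_point kap r base) / 15)
      (dS_coef 6 kap r (s / 5) c)) (base_point kap r base)
    - 2 *: ((\sum_j c j * d j) *: factor_scale kap c (base_point kap r base))).
  by rewrite scalE //; apply/rowP => i; rewrite !mxE; ring.
congr (_ - _ *: _); apply/esym.
  apply: (dS_op_pscale r_gt0 sum_r kap_base card_6 _ _ innerE) => //.
  exact: dS_coef_normal.
exact: (sum_curvature_nabla r_gt0 sum_r kap_base card_6 c0 tauE Mb).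
Qed.

End CHarmonicProduct.

(** * A family of positive quartics *)

Section CliffordPolynomial.
Variable R : realFieldType.
Implicit Types (n s : R).

(** With [s = a ^+ 2], [n = n1] and [n2 = 6 - n], one has
    P = s (1 - s) (|A| ^+ 2 - 6), where A is the second fundamental form of the
    torus, and Q = s (1 - s) Scal.  The C-harmonic equation for a torus whose
    tension does not vanish is [clifford_poly n s = 0]. *)
Definition clifford_poly n s : R :=
  let P := n - (2 * n + 6) * s + 12 * s ^+ 2 in
  let Q := n * (n - 1) * (1 - s) + (6 - n) * (5 - n) * s in
  (P + 2 / 15 * Q) * (P + Q / 5) - 2 * (n - 6 * s) ^+ 2 * (s * (1 - s)).

(** Exchange of the two factors of the torus. *)
Lemma clifford_poly_sym n s : clifford_poly (6 - n) (1 - s) = clifford_poly n s.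
Proof. by rewrite /clifford_poly; field. Qed.

(** These quartics are positive on the whole line: each one is 216 times the
    square of the first polynomial of the proof, plus a positive multiple of the
    square of the second one, plus a positive constant. *)
Lemma clifford_poly1_gt0 s : 0 < clifford_poly 1 s.
Proof.
rewrite /clifford_poly.
have := sqr_ge0 (s ^+ 2 - 13 / 27 * s + 1 / 25).
have := sqr_ge0 (s - 1017 / 2686).
lra.
Qed.

Lemma clifford_poly2_gt0 s : 0 < clifford_poly 2 s.
Proof.
rewrite /clifford_poly.
have := sqr_ge0 (s ^+ 2 - 20 / 27 * s + 11 / 100).
have := sqr_ge0 (s - 990 / 2581).
lra.
Qed.

Lemma clifford_poly3_gt0 s : 0 < clifford_poly 3 s.
Proof.
rewrite /clifford_poly.
have := sqr_ge0 (s ^+ 2 - s + 11 / 50).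
have := sqr_ge0 (s - 1 / 2).
lra.
Qed.

Lemma clifford_poly_gt0 (n : nat) s : (0 < n < 6)%N -> 0 < clifford_poly n%:R s.
Proof.
case: n => [|[|[|[|[|[|n]]]]]] // _.
- exact: clifford_poly1_gt0.
- exact: clifford_poly2_gt0.
- exact: clifford_poly3_gt0.
- rewrite -clifford_poly_sym (_ : 6 - 4%:R = 2); last by ring.
  exact: clifford_poly2_gt0.
- rewrite -clifford_poly_sym (_ : 6 - 5%:R = 1); last by ring.
  exact: clifford_poly1_gt0.
Qed.

End CliffordPolynomial.

(** * Clifford tori *)

Section CliffordTorus.
Variables (R : realType) (n1 n2 : nat) (a b : R).
Hypotheses (a_gt0 : 0 < a) (b_gt0 : 0 < b).

Definition in_first_factor (i : 'I_(n1.+1 + n2.+1)) : bool := (i < n1.+1)%N.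

Definition torus_radius (k : bool) : R := if k then a else b.

Definition torus_base (k : bool) : 'I_(n1.+1 + n2.+1) :=
  if k then lshift _ ord0 else rshift _ ord0.

Lemma in_first_factor_lshift i : in_first_factor (lshift n2.+1 i).
Proof. by rewrite /in_first_factor /=. Qed.

Lemma in_first_factor_rshift i : in_first_factor (rshift n1.+1 i) = false.
Proof. by rewrite /in_first_factor /= ltnNge leq_addr. Qed.

Lemma torus_baseK : cancel torus_base in_first_factor.
Proof. by case; rewrite /= ?in_first_factor_lshift ?in_first_factor_rshift. Qed.

Lemma pdot_torus k (u v : 'rV[R]_(n1.+1 + n2.+1)) :
  factor_dot in_first_factor k u v =
  if k then dotp (lsubmx u) (lsubmx v) else dotp (rsubmx u) (rsubmx v).
Proof.
rewrite /factor_dot big_split_ord /=.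
under eq_bigl do rewrite in_first_factor_lshift.
under [X in _ + X]eq_bigl do rewrite in_first_factor_rshift.
case: k => /=; rewrite ?big_pred0_eq ?addr0 ?add0r;
  by apply: eq_bigr => i _; rewrite !mxE.
Qed.

Lemma enorm_eq m (u : 'rV[R]_m) t : 0 < t -> enorm u = t <-> dotp u u = t ^+ 2.
Proof.
move=> t0; rewrite /enorm; split=> [<-|->]; last by rewrite sqrtr_sqr gtr0_norm.
rewrite sqr_sqrtr //.
by apply: sumr_ge0 => i _; rewrite -expr2 sqr_ge0.
Qed.

Lemma clifford_torusE :
  clifford_torus n1 n2 a b = prod_spheres in_first_factor torus_radius.
Proof.
apply/seteqP; split=> p; rewrite /clifford_torus /prod_spheres /=.
  by rewrite !enorm_eq // => -[pa pb] [] /=; rewrite pdot_torus.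
move=> pr; rewrite !enorm_eq //.
by have := pr true; have := pr false; rewrite !pdot_torus.
Qed.

Lemma factor_dim_torus k :
  factor_dim R in_first_factor k = (if k then n1 else n2)%:R.
Proof.
rewrite /factor_dim -sum1_card big_split_ord /=.
under eq_bigl do rewrite inE in_first_factor_lshift.
under [X in (_ + X)%N]eq_bigl do rewrite inE in_first_factor_rshift.
by case: k => /=;
  rewrite big_pred0_eq sum1_card card_ord ?addn0 ?add0n -natr1 addrK.
Qed.

End CliffordTorus.

Theorem proposition1p21 (R : realType) (n1 n2 : nat)
    (hn1 : (0 < n1)%N) (hn2 : (0 < n2)%N) (hn : (n1 + n2 = 6)%N)
    (a b : R) (ha0 : 0 < a) (ha1 : a < 1) (hb : b = Num.sqrt (1 - a ^+ 2)) :
  ~ properly_C_harmonic (clifford_torus n1 n2 a b)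
      (unit_sphere R (n1.+1 + n2.+1)).
Proof.
have s_lt1 : 0 < 1 - a ^+ 2 by rewrite subr_gt0 expr_lt1 // ltW.
have b_gt0 : 0 < b by rewrite hb sqrtr_gt0.
have bsq : b ^+ 2 = 1 - a ^+ 2 by rewrite hb sqr_sqrtr // ltW.
rewrite clifford_torusE //.
set kap := @in_first_factor n1 n2; set r := torus_radius a b.
have r_gt0 k : 0 < r k by case: k.
have sum_r : \sum_k r k ^+ 2 = 1 by rewrite big_bool /= bsq addrC subrK.
have card_6 : (6 + #|{: bool}| = n1.+1 + n2.+1)%N.
  by rewrite card_bool [RHS]addSn [in RHS]addnS hn.
have kapK := @torus_baseK n1 n2.
set s := a ^+ 2 in s_lt1 bsq.
have s_gt0 : 0 < s by rewrite exprn_gt0.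
have s0 : s != 0 by rewrite gt_eqF.
have s1 : 1 - s != 0 by rewrite gt_eqF.
have n2E : n2%:R = 6 - n1%:R :> R.
  by rewrite -[6]/(6%:R) -hn natrD addrAC subrr add0r.
(* Up to the factor C, the tension field is (x / s, - y / (1 - s)) at (x, y). *)
pose C : R := n1%:R - 6 * s.
have coefE l k : rough_coef kap r l k
    = l k * (if k then n1%:R / s else n2%:R / (1 - s))
      - (l true * n1%:R + l false * n2%:R).
  rewrite /rough_coef big_bool /= !factor_dim_torus.
  by case: k => /=; rewrite ?bsq mulrA.
have cE k : tension_coef kap r k = C * (if k then s^-1 else - (1 - s)^-1).
  rewrite /tension_coef coefE n2E /C; case: k; field.
    by [].
  by [].
move=> [harm nharm].
have C_neq0 : C != 0.
  apply/eqP => C0; apply: nharm.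
  by apply: (harmonic_prod_spheres r_gt0 sum_r kapK card_6) => k;
    rewrite cE C0 mul0r.
have := C_harmonic_prod_spheres r_gt0 sum_r kapK card_6 harm true.
rewrite /= !big_bool /= !factor_dim_torus /dS_coef !coefE !cE /= n2E bsq.
rewrite -/s => E.
have n1_6 : (0 < n1 < 6)%N by rewrite hn1 -hn -[X in (X < _)%N]addn0 ltn_add2l.
have := clifford_poly_gt0 s n1_6.
suff -> : clifford_poly n1%:R s = 0 by rewrite ltxx.
apply: (mulfI C_neq0); rewrite mulr0.
(* The equation in the first factor is C / s times the quartic, divided by
   (s * (1 - s)) ^+ 2. *)
rewrite -[RHS](mulr0 (s * (s * (1 - s)) ^+ 2)) -E /clifford_poly /C.
by field; rewrite s0 s1.
Qed.
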